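(* Let $q$ be a prime power, $m,s$ positive integers. Let $\alpha\in\mathbb{F}_{q^m}$ be an $\mathbb{F}_q$-normal element, $B=\{\alpha,\alpha^{q},\dots,\alpha^{q^{m-1}}\}$ the normal basis of $\mathbb{F}_{q^m}$ over $\mathbb{F}_q$ determined by $\alpha$, and $B'=\{u,u^{q},\dots,u^{q^{m-1}}\}$ the dual basis of $B$. Let $\psi: M_m(\mathcal{R}_{q,s})\to R_m$ be the map attached to $B$ described in the context. Let $c(x)=\sum_{i=0}^{s-1}c_i x^i\in\mathcal{R}_{q,s}$ with $c_i\in\mathbb{F}_q$. Then: 1. The set $\{O_{jk}x^{i}: j,k\in\{1,\dots,m\},\ i\in\{0,\dots,s-1\}\}$ is an $\mathbb{F}_q$-basis of $M_m(\mathcal{R}_{q,s})$. In addition, for all $j,k\in\{1,\dots,m\}$, $$\psi(O_{jk}c(x))=\sum_{i=0}^{s-1}\sum_{r=0}^{m-1}c_i\left(\alpha^{q^{j}}u^{q^{k+r}}\right)x^{q^{mi+r}}.$$ In particular, if $B$ is a self-dual normal basis of $\mathbb{F}_{q^m}$ over $\mathbb{F}_q$ (that is, $u=\alpha$), then for all $j,k\in\{1,\dots,m\}$, $\psi(O_{jk}c(x))=\sum_{i=0}^{s-1}\sum_{r=0}^{m-1}c_i\left(\alpha^{q^{j}+q^{k+r}}\right)x^{q^{mi+r}}$. 2. If $j,k\in\{1,\dots,m\}$ are distinct, then $$\psi(\chi_{jk}(c(x)))=x+\sum_{i=0}^{s-1}\sum_{r=0}^{m-1}c_i\left(\alpha^{q^{j}}u^{q^{k+r}}\right)x^{q^{mi+r}}.$$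 In particular, if $B$ is self-dual, then $\psi(\chi_{jk}(c(x)))=x+\sum_{i=0}^{s-1}\sum_{r=0}^{m-1}c_i\left(\alpha^{q^{j}+q^{k+r}}\right)x^{q^{mi+r}}$. 3. If $t(x)=\sum_{i=0}^{s-1}t_i x^i\in\mathcal{R}_{q,s}$ (with $t_i\in\mathbb{F}_q$) is such that $t(x)+1$ is a unit of $\mathcal{R}_{q,s}$, and $l\in\{1,\dots,m\}$, then $$\psi(D_l(t(x)+1))=x+\sum_{i=0}^{s-1}\sum_{r=0}^{m-1}t_i\left(\alpha^{q^{l}}u^{q^{l+r}}\right)x^{q^{mi+r}}.$$ In particular, if $B$ is self-dual, then $\psi(D_l(t(x)+1))=x+\sum_{i=0}^{s-1}\sum_{r=0}^{m-1}t_i\left(\alpha^{q^{l}(1+q^{r})}\right)x^{q^{mi+r}}$.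
   Context: Let $n=ms$. $\mathcal{R}_{q,s}:=\mathbb{F}_q[x]/\langle x^s-1\rangle$, and $M_m(\mathcal{R}_{q,s})$ is the algebra of $m\times m$ matrices over it. $R_m$ is the set of linear polynomials $\sum_{i=0}^{n-1}f_i x^{q^i}$ with all $f_i\in\mathbb{F}_{q^m}$, viewed as $\mathbb{F}_q$-linear maps $\mathbb{F}_{q^n}\to\mathbb{F}_{q^n}$ (equivalently, polynomials modulo $x^{q^n}-x$). An element $\alpha\in\mathbb{F}_{q^m}$ is $\mathbb{F}_q$-normal if $\{\alpha,\alpha^q,\dots,\alpha^{q^{m-1}}\}$ is an $\mathbb{F}_q$-basis of $\mathbb{F}_{q^m}$ (a normal basis). The dual basis $\{u,u^q,\dots,u^{q^{m-1}}\}$ satisfies $\mathrm{Tr}_{\mathbb{F}_{q^m}/\mathbb{F}_q}(\alpha^{q^i}u^{q^j})=1$ if $i=j$ and $0$ if $i\ne j$, $0\le i,j\le m-1$ (the dual of a normal basis is normal). $B$ is self-dual if it is its own dual basis, with $u=\alpha$. The map $\psi$: any $G\in M_m(\mathcal{R}_{q,s})$ is uniquely $G=G_0+G_1x+\cdots+G_{s-1}x^{s-1}$ with $G_i\in M_m(\mathbb{F}_q)$. For each $i$ let $g_i(x)=\sum_{r=0}^{m-1}a_{ir}x^{q^r}$, $a_{ir}\in\mathbb{F}_{q^m}$, be the unique such polynomial whose associated $\mathbb{F}_q$-linear map $\mathbb{F}_{q^m}\to\mathbb{F}_{q^m}$ has matrix $[g_i]_B=G_i$ on the basis $B$. Then $\psi(G):=\sum_{i=0}^{s-1}g_i(x^{q^{mi}})$.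 Convention for $[\cdot]_B$: rows and columns are indexed by $1,\dots,m$, with index $j$ corresponding to the basis element $\alpha^{q^j}$ (so index $m$ corresponds to $\alpha^{q^m}=\alpha$); the $k$-th column of $[g]_B$ is the coordinate vector of $g(\alpha^{q^k})$. $O_{jk}$ is the $m\times m$ matrix with $1$ in the $jk$-entry and $0$ elsewhere. For $j\neq k$, the transvection $\chi_{jk}(c(x))$ has $c(x)$ in the $jk$-entry, $1$ in all diagonal entries, and $0$ elsewhere. For a unit $v(x)$ of $\mathcal{R}_{q,s}$, $D_l(v(x))$ has $v(x)$ in the $ll$-entry, $1$ in the other diagonal entries, and $0$ elsewhere. *)

(* Defs.v *)
From HB Require Import structures.
From mathcomp Require Import all_boot all_order all_algebra all_fingroup.
From mathcomp Require Import all_solvable all_field.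
From mathcomp Require Import qpoly.

Set Implicit Arguments.
Unset Strict Implicit.
Unset Printing Implicit Defensive.

Import GRing.Theory VectorInternalTheory.
Local Open Scope ring_scope.

(* R_{q,s} = F_q[x] / <x^s - 1>. An element coerces to its representative of   *)
(* degree < s, so the coefficient of x^i (i < s) in c is c`_i. For s > 0 the   *)
(* polynomial x^s - 1 is monic of positive degree, as {poly %/ _} requires.    *)
Notation Rqs F s := {poly %/ ('X^s - 1 : {poly F})}.

(* MathComp gives 'M[Rqs F s]_m a module structure over Rqs F s only. mxRqs is *)
(* the same type, seen as a finite-dimensional vector space over F for the     *)
(* entrywise action of F.                                                      *)
Definition mxRqs (F : fieldType) (s m : nat) : predArgType := 'M[Rqs F s]_m.

Section MatrixOverF.

Variables (F : fieldType) (s m : nat).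

HB.instance Definition _ := GRing.Zmodule.copy (mxRqs F s m) 'M[Rqs F s]_m.

Definition mxRqs_scale (a : F) (A : mxRqs F s m) : mxRqs F s m :=
  \matrix_(j, k) (a *: A j k).

Fact mxRqs_scaleA a b A :
  mxRqs_scale a (mxRqs_scale b A) = mxRqs_scale (a * b) A.
Proof. by apply/matrixP=> j k; rewrite !mxE scalerA. Qed.

Fact mxRqs_scale1 : left_id 1 mxRqs_scale.
Proof. by move=> A; apply/matrixP=> j k; rewrite !mxE scale1r. Qed.

Fact mxRqs_scaleDr : right_distributive mxRqs_scale +%R.
Proof. by move=> a A B; apply/matrixP=> j k; rewrite !mxE scalerDr. Qed.

Fact mxRqs_scaleDl A : {morph mxRqs_scale^~ A : a b / a + b}.
Proof. by move=> a b; apply/matrixP=> j k; rewrite !mxE scalerDl. Qed.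

HB.instance Definition _ := GRing.Zmodule_isLmodule.Build F (mxRqs F s m)
  mxRqs_scaleA mxRqs_scale1 mxRqs_scaleDr mxRqs_scaleDl.

Fact mxRqs_vect_iso :
  Vector.axiom (dim {ffun 'I_m * 'I_m -> Rqs F s}) (mxRqs F s m).
Proof.
pose f (A : mxRqs F s m) : {ffun 'I_m * 'I_m -> Rqs F s} :=
  [ffun p => A p.1 p.2].
pose g (h : {ffun 'I_m * 'I_m -> Rqs F s}) : mxRqs F s m :=
  \matrix_(j, k) h (j, k).
have f_lin : linear f by move=> a A B; apply/ffunP=> p; rewrite !ffunE !mxE.
have fK : cancel f g by move=> A; apply/matrixP=> j k; rewrite mxE ffunE.
have gK : cancel g f by move=> h; apply/ffunP=> -[j k]; rewrite ffunE mxE.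
exists (v2r \o f); first by move=> a A B; rewrite /= f_lin linearP.
by exists (g \o r2v) => [A|w] /=; rewrite ?v2rK ?fK ?gK ?r2vK.
Qed.

HB.instance Definition _ :=
  Lmodule_hasFinDim.Build F (mxRqs F s m) mxRqs_vect_iso.

End MatrixOverF.

(* Matrix indices 1, ..., m are represented by j : 'I_m, standing for j.+1;    *)
(* none of the next three constructions depends on the shift.                  *)

Definition monomial_mx (F : fieldType) (s m : nat)
    (p : 'I_m * 'I_m * 'I_s) : mxRqs F s m :=
  let: (j, k, i) := p in 'qX ^+ i *: (delta_mx j k : 'M[Rqs F s]_m).

Definition transvection (A : nzRingType) (m : nat) (j k : 'I_m) (c : A) :
    'M[A]_m :=
  \matrix_(a, b) if (a == j) && (b == k) then c else (a == b)%:R.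

Definition dilation (A : nzRingType) (m : nat) (l : 'I_m) (v : A) : 'M[A]_m :=
  \matrix_(a, b) if (a == l) && (b == l) then v else (a == b)%:R.

Section Psi.

(* F = F_q, L = F_{q^n} and K = F_{q^m}, a subfield of L, when                 *)
(* \dim {:L} = n and \dim K = m.                                               *)
Variables (F : finFieldType) (L : splittingFieldType F) (K : {subfield L}).
Variables (m s : nat).

Local Notation q := #|F|.

Definition normal_element (alpha : L) : bool :=
  basis_of K [seq alpha ^+ (q ^ i) | i <- iota 0 m].

Definition dual_normal (alpha u : L) : Prop :=
  u \in K /\
  forall i j : 'I_m,
    galTrace 1%AS K (alpha ^+ (q ^ i) * u ^+ (q ^ j)) = (i == j)%:R.

Definition self_dual (alpha : L) : Prop := dual_normal alpha alpha.

(* The ordering of B used for matrices: the basis element of index j.+1 is     *)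
(* alpha^(q^(j.+1)), the last one being alpha^(q^m) = alpha.                   *)
Definition normal_basis (alpha : L) : m.-tuple L :=
  [tuple alpha ^+ (q ^ j.+1) | j < m].

Definition lin_poly (d : nat) (a : 'I_d -> L) : {poly L} :=
  \sum_(i < d) a i *: 'X^(q ^ i).

(* R_m. Its elements are the reduced representatives modulo x^(q^n) - x of the *)
(* induced maps L -> L, so equality in R_m is equality of polynomials.         *)
Definition Rm (f : {poly L}) : Prop :=
  exists2 a : 'I_(m * s) -> L, forall i, a i \in K & f = lin_poly a.

(* [g]_B *)
Definition mx_of_poly (alpha : L) (g : {poly L}) : 'M[F]_m :=
  \matrix_(j, k) coord (normal_basis alpha) j g.[tnth (normal_basis alpha) k].

(* The polynomial g = sum_{r < m} a_r x^(q^r), a_r in K, with [g]_B = G. Such  *)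
(* a g exists and is unique when alpha is normal and \dim K = m, so the default *)
(* value 0 is then irrelevant. finvect_type L is L with its finType structure.  *)
Definition poly_of_mx (alpha : L) (G : 'M[F]_m) : {poly L} :=
  if [pick a : {ffun 'I_m -> finvect_type L} |
        [forall r, (a r : L) \in K] && (mx_of_poly alpha (lin_poly a) == G)]
  is Some a then lin_poly a else 0.

Definition coef_mx (G : 'M[Rqs F s]_m) (i : nat) : 'M[F]_m :=
  \matrix_(j, k) (G j k)`_i.

Definition psi (alpha : L) (G : 'M[Rqs F s]_m) : {poly L} :=
  \sum_(i < s) (poly_of_mx alpha (coef_mx G i) \Po 'X^(q ^ (m * i))).

Lemma psi_Rm alpha G : Rm (psi alpha G).
Proof.
have Rm0 : Rm 0.
  exists (fun=> 0) => [i|]; first exact: rpred0.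
  by rewrite /lin_poly big1 // => i _; rewrite scale0r.
have RmD f g : Rm f -> Rm g -> Rm (f + g).
  case=> a aK -> [b bK ->]; exists (fun i => a i + b i) => [i|].
    exact: rpredD.
  by rewrite -big_split; apply: eq_bigr => i _; rewrite scalerDl.
apply: (big_ind Rm) => // i _; rewrite /poly_of_mx.
case: pickP => [a /andP[/forallP aK _]|_]; last by rewrite comp_poly0.
rewrite raddf_sum /=; apply: (big_ind Rm) => // r _.
have ltmir : (m * i + r < m * s)%N.
  apply: (@leq_trans (m * i.+1)); last by rewrite leq_mul2l ltn_ord orbT.
  by rewrite mulnS addnC ltn_add2r.
exists (fun k => if k == Ordinal ltmir then a r : L else 0) => [k|].
  by case: ifP => _; rewrite ?rpred0 //; exact: aK.
rewrite /lin_poly (bigD1 (Ordinal ltmir)) //= eqxx big1 ?addr0.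
  by rewrite comp_polyZ comp_Xn_poly -exprM -expnD.
by move=> k /negbTE->; rewrite scale0r.
Qed.

End Psi.

(* Main.v *)
Require Import Defs.
From HB Require Import structures.
From mathcomp Require Import all_boot all_order all_algebra all_fingroup.
From mathcomp Require Import all_solvable all_field.
From mathcomp Require Import qpoly.

Set Implicit Arguments.
Unset Strict Implicit.
Unset Printing Implicit Defensive.

Import GRing.Theory.
Local Open Scope ring_scope.

(** Write b_k = alpha^(q^(k+1)) and u_k = u^(q^(k+1)) for the two dual bases.
    The trace form identifies End(K) with K (x) K: the matrix unit O_jk is the
    map z |-> Tr(u_k z) b_j, and since the trace of K over F is the sum of the
    m powers of the Frobenius map [galTrace_sum_Frobenius], this map is
    z |-> sum_r b_j u_k^(q^r) z^(q^r). That is the linear polynomial whose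
    coefficients appear in the theorem, and the formula extends linearly to
    any matrix G, with coefficients [dual_coef G].

    The duality of the bases, written with sums of Frobenius powers, says that
    the matrices (alpha^(q^(k+1+r)))_(k,r) and (u^(q^(l+1+r)))_(l,r) are inverse
    to each other up to transposition. The product in one order
    [dual_coef_shifts] shows that the polynomial with coefficients [dual_coef G]
    has matrix G; the product in the other order [dual_basis_shifts] recovers
    the coefficients of a linear polynomial from its values on the basis, hence
    shows that no other polynomial has matrix G. So [poly_of_mxE] makes explicit the
    polynomial that psi attaches to each coefficient matrix.

    It follows that psi is additive [psiD], that it has the stated value on
    c O_jk [psi_delta], and that psi(1) = x [psi1]. Transvections and dilations
    are of the form 1 + c O_jk, so these values determine theirs. The self-dual
    formulas are the case u = alpha. For the basis statement, the powers of x
    below s span the quotient ring [sum_qX], so the m m s monomial matrices span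
    a space of dimension m m s. *)

(** * The trace of a finite field *)

(** The Galois group of K over F is cyclic, generated by x |-> x^q, so that the
    trace runs over the powers of this generator. *)
Lemma galTrace_sum_Frobenius (F : finFieldType) (L : splittingFieldType F)
    (K : {subfield L}) (a : L) :
  a \in K -> galTrace 1%AS K a = \sum_(i < \dim K) a ^+ (#|F| ^ i).
Proof.
move=> Ka.
have [x /eqP galK xE] := finField_galois_generator (sub1v K).
have {xE} xE b : b \in K -> x b = b ^+ #|F|.
  by move/xE->; rewrite dimv1 expn1.
have xnE n : (x ^+ n)%g a = a ^+ (#|F| ^ n).
  elim: n => [|n IHn]; first by rewrite gal_id.
  by rewrite expgSr galM // IHn xE ?rpredX // -exprM expnSr.
have <- : #[x]%g = \dim K.
  by rewrite /order -galK -(galois_dim (finField_galois (sub1v K))) dimv1 divn1.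
have cycE : <[x]>%g = [set (x ^+ i)%g | i : 'I_#[x]%g].
  apply/setP=> y; apply/idP/imsetP => [/cyclePmin[i lti ->]|[i _ ->]].
    by exists (Ordinal lti).
  exact: mem_cycle.
rewrite /galTrace galK cycE big_imset /= => [|i j _ _ /eqP]; last first.
  by rewrite eq_expg_mod_order !modn_small // => /eqP/val_inj.
exact: eq_bigr.
Qed.

Lemma horner_lin_poly (F : finFieldType) (L : splittingFieldType F) d
    (a : 'I_d -> L) x :
  (lin_poly a).[x] = \sum_(r < d) a r * x ^+ (#|F| ^ r).
Proof.
by rewrite horner_sum; apply: eq_bigr => r _; rewrite hornerZ hornerXn.
Qed.

(** * Linear polynomials and matrices over dual normal bases *)

Section DualNormalBases.

Variables (F : finFieldType) (L : splittingFieldType F) (K : {subfield L}).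
Variables (m : nat) (alpha u : L).
Hypotheses (m_gt0 : (0 < m)%N) (dimK : \dim K = m).
Hypothesis alphaN : normal_element K m alpha.
Hypothesis alphauD : dual_normal K m alpha u.

Local Notation q := #|F|.

Lemma expq_dim a : a \in K -> a ^+ (q ^ m) = a.
Proof. by rewrite Fermat's_little_theorem dimK => /eqP. Qed.

(** Passing from the exponents 0, ..., m-1 to 1, ..., m permutes the conjugates
    cyclically. This reconciles the two numberings of the normal basis: from 0
    in the definition of duality, from 1 in the matrix of a map. *)
Lemma sum_expqS a :
  a \in K -> \sum_(i < m) a ^+ (q ^ i.+1) = \sum_(i < m) a ^+ (q ^ i).
Proof.
case: m expq_dim => [|n] aqK Ka; first by rewrite !big_ord0.
rewrite big_ord_recr big_ord_recl /= addrC; congr (_ + _).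
by rewrite aqK // expn0 expr1.
Qed.

Lemma normal_element_mem : alpha \in K.
Proof.
apply: (basis_mem alphaN); apply/mapP; exists 0%N; last by rewrite expn0 expr1.
by rewrite mem_iota.
Qed.

Let Kalpha := normal_element_mem.
Let Ku : u \in K := proj1 alphauD.

Lemma dual_sum_Frobenius (i j : 'I_m) :
  \sum_(r < m) alpha ^+ (q ^ (i + r)) * u ^+ (q ^ (j + r)) = (i == j)%:R.
Proof.
have [_ <-] := alphauD; rewrite galTrace_sum_Frobenius ?rpredM ?rpredX // dimK.
by apply: eq_bigr => r _; rewrite exprMn -!exprM -!expnD.
Qed.

Lemma dual_coef_shifts (k l : 'I_m) :
  \sum_(r < m) alpha ^+ (q ^ (k.+1 + r)) * u ^+ (q ^ (l.+1 + r)) = (k == l)%:R.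
Proof.
pose a := alpha ^+ (q ^ k) * u ^+ (q ^ l).
have Ka : a \in K by rewrite rpredM ?rpredX.
rewrite -dual_sum_Frobenius.
transitivity (\sum_(r < m) a ^+ (q ^ r.+1)); last rewrite sum_expqS //.
  by apply: eq_bigr => r _; rewrite exprMn -!exprM -!expnD !addSnnS.
by apply: eq_bigr => r _; rewrite exprMn -!exprM -!expnD.
Qed.

(** The exponent k+1+r is symmetric in k and r, so the orthogonality of rows is
    also that of columns. *)
Lemma dual_basis_shifts (r t : 'I_m) :
  \sum_(k < m) alpha ^+ (q ^ (k.+1 + r)) * u ^+ (q ^ (k.+1 + t)) = (r == t)%:R.
Proof.
rewrite -dual_coef_shifts; apply: eq_bigr => k _.
by rewrite !(addSnnS k) !(addnC k).
Qed.

Lemma normal_basisE (j : 'I_m) :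
  (normal_basis m alpha)`_j = alpha ^+ (q ^ j.+1).
Proof. by rewrite -tnth_nth tnth_mktuple. Qed.

Lemma normal_basis_basis : basis_of K (normal_basis m alpha).
Proof.
have nbE :
    normal_basis m alpha = [seq alpha ^+ (q ^ i) | i <- iota 1 m] :> seq L.
  by rewrite -[1%N]addn0 iotaDl -map_comp -val_enum_ord -map_comp.
move: alphaN; rewrite nbE /normal_element.
(* The two enumerations differ by a rotation, since alpha^(q^m) = alpha. *)
case: m m_gt0 expq_dim => // n _ aqK; congr (is_true _); apply: perm_basis.
rewrite -[in X in perm_eq _ X](addn1 n) iotaD map_cat perm_sym perm_catC /=.
by rewrite add1n aqK.
Qed.

(** The coefficients of z |-> \sum_(j, k) G_jk Tr(u_k z) b_j, the map of
    matrix G on the basis b_j = alpha^(q^(j+1)) with dual basis u_k. *)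
Definition dual_coef (G : 'M[F]_m) (r : 'I_m) : L :=
  \sum_j \sum_k G j k *: (alpha ^+ (q ^ j.+1) * u ^+ (q ^ (k.+1 + r))).

Lemma dual_coef_mem G r : dual_coef G r \in K.
Proof.
rewrite !rpred_sum // => j _; rewrite rpred_sum // => k _.
by rewrite rpredZ ?rpredM ?rpredX.
Qed.

Lemma dual_coefD G H r : dual_coef (G + H) r = dual_coef G r + dual_coef H r.
Proof.
rewrite -big_split; apply: eq_bigr => j _ /=; rewrite -big_split.
by apply: eq_bigr => k _; rewrite mxE scalerDl.
Qed.

Lemma dual_coefZ b G r : dual_coef (b *: G) r = b *: dual_coef G r.
Proof.
rewrite scaler_sumr; apply: eq_bigr => j _; rewrite scaler_sumr.
by apply: eq_bigr => k _; rewrite mxE scalerA.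
Qed.

Lemma dual_coef_delta j k r :
  dual_coef (delta_mx j k) r = alpha ^+ (q ^ j.+1) * u ^+ (q ^ (k.+1 + r)).
Proof.
rewrite /dual_coef (bigD1 j) //= [X in _ + X]big1 ?addr0 => [|i /negPf ne_ij].
  rewrite (bigD1 k) //= [X in _ + X]big1 ?addr0 => [|l /negPf ne_lk].
    by rewrite !mxE !eqxx scale1r.
  by rewrite !mxE ne_lk andbF scale0r.
by apply: big1 => l _; rewrite !mxE ne_ij scale0r.
Qed.

(** The identity matrix must give the polynomial x; on coefficients this is the
    orthogonality of the columns r and 0. *)
Lemma dual_coef1 r : dual_coef 1%:M r = (r == 0%N :> nat)%:R.
Proof.
pose r0 := Ordinal m_gt0.
rewrite (eq_sym _ 0%N) -[0%N == r]/(r0 == r) -dual_basis_shifts.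
apply: eq_bigr => j _; rewrite (bigD1 j) //= mxE eqxx scale1r addn0.
by rewrite big1 ?addr0 // => k /negPf; rewrite eq_sym mxE => ->; rewrite scale0r.
Qed.

(** Existence of a linear polynomial with matrix G: evaluating at b_k, the sum
    over r is the trace of u_l b_k, which selects the column l = k of G. *)
Lemma mx_of_poly_dual_coef G : mx_of_poly m alpha (lin_poly (dual_coef G)) = G.
Proof.
apply/matrixP=> j k; rewrite mxE tnth_mktuple horner_lin_poly.
set b := \sum_(r < m) _.
have -> : b = \sum_i G i k *: (normal_basis m alpha)`_i.
  rewrite /b /dual_coef.
  under eq_bigr do rewrite mulr_suml.
  rewrite exchange_big; apply: eq_bigr => i _ /=; rewrite normal_basisE.
  under eq_bigr do rewrite mulr_suml.
  rewrite exchange_big /= (bigD1 k) //= [X in _ + X]big1 ?addr0 => [|l ne_lk].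
    under eq_bigr do rewrite -scalerAl -mulrA [X in _ * X]mulrC -exprM -expnD.
    by rewrite -scaler_sumr -mulr_sumr dual_coef_shifts eqxx mulr1.
  under eq_bigr do rewrite -scalerAl -mulrA [X in _ * X]mulrC -exprM -expnD.
  rewrite -scaler_sumr -mulr_sumr dual_coef_shifts eq_sym (negPf ne_lk).
  by rewrite mulr0 scaler0.
by rewrite coord_sum_free // (basis_free normal_basis_basis).
Qed.

(** Uniqueness: the values g(b_k) determine the coefficients, by inverting the
    linear system g(b_k) = sum_r a_r alpha^(q^(k+1+r)) with the dual basis. *)
Lemma lin_poly_coefE (a : 'I_m -> L) :
  (forall r, a r \in K) -> a =1 dual_coef (mx_of_poly m alpha (lin_poly a)).
Proof.
move=> Ka t; rewrite /dual_coef exchange_big /=.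
set g := lin_poly a.
have gE (k : 'I_m) :
    \sum_j mx_of_poly m alpha g j k *: alpha ^+ (q ^ j.+1)
      = g.[alpha ^+ (q ^ k.+1)].
  have Kg : g.[alpha ^+ (q ^ k.+1)] \in K.
    by rewrite horner_lin_poly rpred_sum // => r _; rewrite rpredM ?rpredX.
  rewrite [RHS](coord_basis normal_basis_basis Kg).
  by apply: eq_bigr => j _; rewrite mxE normal_basisE tnth_mktuple.
under eq_bigr => k _ do under eq_bigr => j _ do rewrite scalerAl.
under eq_bigr => k _ do rewrite -mulr_suml gE horner_lin_poly mulr_suml.
rewrite exchange_big (bigD1 t) //= [X in _ + X]big1 ?addr0 => [|r ne_rt].
  under eq_bigr do rewrite -exprM -expnD -mulrA.
  by rewrite -mulr_sumr dual_basis_shifts eqxx mulr1.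
under eq_bigr do rewrite -exprM -expnD -mulrA.
by rewrite -mulr_sumr dual_basis_shifts (negPf ne_rt) mulr0.
Qed.

Lemma poly_of_mxE G : poly_of_mx K alpha G = lin_poly (dual_coef G).
Proof.
rewrite /poly_of_mx; case: pickP => [a /andP[/forallP Ka /eqP <-]|].
  by apply: eq_bigr => r _; rewrite -lin_poly_coefE.
move/(_ [ffun r => dual_coef G r : finvect_type L]); case/negP.
apply/andP; split; first by apply/forallP=> r; rewrite ffunE dual_coef_mem.
rewrite -{2}[G]mx_of_poly_dual_coef; apply/eqP; congr (mx_of_poly _ _ _).
by apply: eq_bigr => r _; rewrite ffunE.
Qed.

(** * The map psi *)

Variable (s : nat).

Lemma psiE (G : 'M[Rqs F s]_m) :
  psi K alpha G =
    \sum_(i < s) \sum_(r < m) dual_coef (coef_mx G i) r *: 'X^(q ^ (m * i + r)).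
Proof.
apply: eq_bigr => i _; rewrite poly_of_mxE raddf_sum; apply: eq_bigr => r _.
by rewrite /= comp_polyZ comp_Xn_poly -exprM -expnD.
Qed.

Lemma psiD (G H : 'M[Rqs F s]_m) :
  psi K alpha (G + H) = psi K alpha G + psi K alpha H.
Proof.
rewrite !psiE -big_split; apply: eq_bigr => i _ /=; rewrite -big_split.
apply: eq_bigr => r _ /=; rewrite -scalerDl -dual_coefD.
by congr (dual_coef _ _ *: _); apply/matrixP=> j k; rewrite !mxE coefD.
Qed.

Lemma psi_delta (c : Rqs F s) (j k : 'I_m) :
  psi K alpha (c *: delta_mx j k) =
    \sum_(i < s) \sum_(r < m)
      (c`_i *: (alpha ^+ (q ^ j.+1) * u ^+ (q ^ (k.+1 + r))))
        *: 'X^(q ^ (m * i + r)).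
Proof.
rewrite psiE; apply: eq_bigr => i _; apply: eq_bigr => r _.
rewrite -dual_coef_delta -dual_coefZ; congr (dual_coef _ _ *: _).
apply/matrixP=> a b; rewrite !mxE.
by case: (_ && _); rewrite ?mulr1 // !mulr0 coef0.
Qed.

Lemma psi1 : (0 < s)%N -> psi K alpha (1%:M : 'M[Rqs F s]_m) = 'X.
Proof.
move=> s_gt0.
rewrite psiE (bigD1 (Ordinal s_gt0)) //= (bigD1 (Ordinal m_gt0)) //=.
have cE i : coef_mx (1%:M : 'M[Rqs F s]_m) i = (i == 0%N)%:R *: 1%:M.
  apply/matrixP=> j k; rewrite !mxE; case: (j == k).
    by rewrite mulr1 coefC; case: (i == _).
  by rewrite mulr0 coef0.
rewrite [X in _ + X]big1 ?addr0 => [|i /negPf ne_i0]; last first.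
  apply: big1 => r _; rewrite cE -[i == _ :> nat]/(i == Ordinal s_gt0) ne_i0.
  by rewrite dual_coefZ !scale0r.
rewrite [X in _ + X]big1 ?addr0 => [|r /negPf ne_r0]; last first.
  rewrite cE scale1r dual_coef1 -[r == _ :> nat]/(r == Ordinal m_gt0) ne_r0.
  by rewrite scale0r.
by rewrite cE scale1r dual_coef1 muln0 addn0 expn0 expr1 scale1r.
Qed.

Lemma psi1D_delta (c : Rqs F s) (j k : 'I_m) :
  (0 < s)%N ->
  psi K alpha (1%:M + c *: delta_mx j k) =
    'X + \sum_(i < s) \sum_(r < m)
      (c`_i *: (alpha ^+ (q ^ j.+1) * u ^+ (q ^ (k.+1 + r))))
        *: 'X^(q ^ (m * i + r)).
Proof. by move=> s_gt0; rewrite psiD psi1 // psi_delta. Qed.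

End DualNormalBases.

(** * Elementary matrices *)

Lemma transvection_delta (A : nzRingType) m (j k : 'I_m) (c : A) :
  j != k -> transvection j k c = 1%:M + c *: delta_mx j k.
Proof.
move=> ne_jk; apply/matrixP=> a b; rewrite !mxE.
case: ifP => [/andP[/eqP-> /eqP->]|_]; last by rewrite mulr0 addr0.
by rewrite (negPf ne_jk) add0r mulr1.
Qed.

Lemma dilation_delta (A : nzRingType) m (l : 'I_m) (t : A) :
  dilation l (t + 1) = 1%:M + t *: delta_mx l l.
Proof.
apply/matrixP=> a b; rewrite !mxE.
case: ifP => [/andP[/eqP-> /eqP->]|_]; last by rewrite mulr0 addr0.
by rewrite eqxx mulr1 addrC.
Qed.

(** * The monomial basis *)

Lemma size_mk_monic_XnsubC (F : fieldType) (s : nat) :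
  (0 < s)%N -> size (mk_monic ('X^s - 1 : {poly F})) = s.+1.
Proof.
move=> s_gt0.
by rewrite /mk_monic size_XnsubC // ltnS s_gt0 monicXnsubC // size_XnsubC.
Qed.

(** Reduction modulo x^s - 1 is a ring morphism that fixes the polynomials of
    degree less than s. The equality holds in the quotient ring, hence also for
    s = 1, where the class of x is 1 and not the polynomial x. *)
Lemma sum_qX (F : fieldType) (s : nat) (c : Rqs F s) :
  (0 < s)%N -> \sum_(i < s) c`_i *: 'qX ^+ i = c.
Proof.
move=> s_gt0; under eq_bigr do rewrite -rmorphXn -in_qpolyZ.
rewrite -raddf_sum /= -poly_def; apply: val_inj => /=.
have szc : (size (c : {poly F}) <= s)%N.
  by rewrite -ltnS -(size_mk_monic_XnsubC F s_gt0) size_mk_monic.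
have -> : \poly_(i < s) c`_i = c.
  apply/polyP=> i; rewrite coef_poly.
  by case: ltnP => // /(leq_trans szc)/(nth_default 0)->.
by rewrite [LHS]in_qpoly_small // size_mk_monic.
Qed.

Lemma monomial_basis (F : fieldType) (s m : nat) :
  (0 < s)%N ->
  basis_of {:mxRqs F s m} [seq monomial_mx F p | p : 'I_m * 'I_m * 'I_s].
Proof.
move=> s_gt0; rewrite basisEdim dimvf size_image !card_prod !card_ord.
(* The dimension comes from the linear isomorphism with finite functions. *)
have -> : dim (mxRqs F s m) =
    (#|{: 'I_m * 'I_m}| * (size (mk_monic ('X^s - 1 : {poly F}))).-1)%N by [].
rewrite card_prod !card_ord size_mk_monic_XnsubC // leqnn andbT.
apply/subvP=> A _.
have -> : A = \sum_(p : 'I_m * 'I_m * 'I_s)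
                 (A p.1.1 p.1.2)`_p.2 *: monomial_mx F p.
  apply/matrixP=> a b; rewrite [RHS]summxE.
  transitivity (\sum_(jk : 'I_m * 'I_m) \sum_(i < s)
      ((A jk.1 jk.2)`_i *: monomial_mx F (jk, i)) a b); last first.
    by rewrite pair_bigA; apply: eq_bigr => -[].
  rewrite (bigD1 (a, b)) //= [X in _ = _ + X]big1 ?addr0 => [|[j k] ne_jk].
    rewrite -{1}(sum_qX (A a b) s_gt0); apply: eq_bigr => i _.
    by rewrite !mxE !eqxx mulr1.
  apply: big1 => i _; rewrite !mxE (eq_sym a) (eq_sym b).
  by rewrite xpair_eqE in ne_jk; rewrite (negPf ne_jk) mulr0 scaler0.
by apply: rpred_sum => p _; rewrite rpredZ // memv_span // image_f.
Qed.

(** * The values of psi on matrix units, transvections and dilations *)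

Theorem theorem7 (q m s : nat) (F : finFieldType) (L : splittingFieldType F)
    (K : {subfield L}) (alpha u : L) (c : Rqs F s) :
  #|F| = q -> (0 < m)%N -> (0 < s)%N ->
  \dim K = m -> \dim {:L} = (m * s)%N ->
  normal_element K m alpha -> dual_normal K m alpha u ->
  [/\
    [/\ basis_of {:mxRqs F s m}
          [seq monomial_mx F p | p : 'I_m * 'I_m * 'I_s],
        forall j k : 'I_m,
          psi K alpha (c *: delta_mx j k) =
            \sum_(i < s) \sum_(r < m)
              (c`_i *: (alpha ^+ (q ^ j.+1) * u ^+ (q ^ (k.+1 + r))))
                *: 'X^(q ^ (m * i + r))
      & self_dual K m alpha ->
        forall j k : 'I_m,
          psi K alpha (c *: delta_mx j k) =
            \sum_(i < s) \sum_(r < m)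
              (c`_i *: alpha ^+ (q ^ j.+1 + q ^ (k.+1 + r)))
                *: 'X^(q ^ (m * i + r))],
    forall j k : 'I_m, j != k ->
      psi K alpha (transvection j k c) =
        'X + \sum_(i < s) \sum_(r < m)
          (c`_i *: (alpha ^+ (q ^ j.+1) * u ^+ (q ^ (k.+1 + r))))
            *: 'X^(q ^ (m * i + r))
      /\ (self_dual K m alpha ->
          psi K alpha (transvection j k c) =
            'X + \sum_(i < s) \sum_(r < m)
              (c`_i *: alpha ^+ (q ^ j.+1 + q ^ (k.+1 + r)))
                *: 'X^(q ^ (m * i + r)))
  & forall (t : Rqs F s) (l : 'I_m), t + 1 \is a GRing.unit ->
      psi K alpha (dilation l (t + 1)) =
        'X + \sum_(i < s) \sum_(r < m)
          (t`_i *: (alpha ^+ (q ^ l.+1) * u ^+ (q ^ (l.+1 + r))))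
            *: 'X^(q ^ (m * i + r))
      /\ (self_dual K m alpha ->
          psi K alpha (dilation l (t + 1)) =
            'X + \sum_(i < s) \sum_(r < m)
              (t`_i *: alpha ^+ (q ^ l.+1 * (1 + q ^ r)))
                *: 'X^(q ^ (m * i + r)))].
Proof.
move=> <- m_gt0 s_gt0 dimK _ aN auD; split.
- split=> [|j k|aD j k]; first exact: monomial_basis.
    exact: psi_delta.
  rewrite (psi_delta m_gt0 dimK aN aD).
  by apply: eq_bigr => i _; apply: eq_bigr => r _; rewrite exprD.
- move=> j k ne_jk; rewrite transvection_delta //; split=> [|aD].
    exact: psi1D_delta.
  rewrite (psi1D_delta m_gt0 dimK aN aD) //; congr (_ + _).
  by apply: eq_bigr => i _; apply: eq_bigr => r _; rewrite exprD.
move=> t l _; rewrite dilation_delta; split=> [|aD].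
  exact: psi1D_delta.
rewrite (psi1D_delta m_gt0 dimK aN aD) //; congr (_ + _).
apply: eq_bigr => i _; apply: eq_bigr => r _.
by rewrite mulnDr muln1 -expnD exprD.
Qed.
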